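(* A generic singular cubic surface has rank five. That is, there is a dense Zariski open subset $U$ of the discriminant hypersurface in the space $\mathbb{P}^{19}$ of cubic surfaces such that every cubic surface in $U$ has rank five.
   Context: A cubic surface is a nonzero homogeneous polynomial $f$ of degree $3$ in four variables with complex coefficients, considered up to scale. It is singular if there is a point of $\mathbb{P}^3_{\mathbb{C}}$ at which all partial derivatives of $f$ vanish; the discriminant is the hypersurface in $\mathbb{P}^{19}$ of singular cubic surfaces. The rank of $f$ is the smallest $r$ such that $f=l_1^3+\cdots+l_r^3$ with $l_i$ complex linear forms. *)

(* Defs.v *)
From HB Require Import structures.
From mathcomp Require Import all_boot all_order all_algebra.
From mathcomp Require Import generic_quotient complex mpoly.
From mathcomp Require Import boolp classical_sets reals.

Set Implicit Arguments.
Unset Strict Implicit.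
Unset Printing Implicit Defensive.

Import GRing.Theory Num.Theory Num.Def.
Local Open Scope ring_scope.
Local Open Scope quotient_scope.
Local Open Scope classical_set_scope.

Definition cubic_form (R : realType) : Type :=
  {f : {mpoly R[i][4]} | (f \is 3.-homog) && (f != 0)}.

HB.instance Definition _ (R : realType) := Choice.on (cubic_form R).

Definition same_surface (R : realType) (f g : cubic_form R) : bool :=
  `[< exists2 c : R[i], c != 0 & val f = c *: val g >].

Lemma same_surface_equiv (R : realType) : equiv_class_of (@same_surface R).
Proof.
split=> [f|f g|g f h].
- by apply/asboolP; exists 1; rewrite ?oner_neq0 ?scale1r.
- suff sym a b : @same_surface R a b -> same_surface b a.
    by apply/idP/idP; apply: sym.
  move=> /asboolP[c c0 e]; apply/asboolP; exists c^-1; first by rewrite invr_neq0.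
  by rewrite e scalerA mulVf // scale1r.
- move=> /asboolP[c c0 e] /asboolP[d d0 e']; apply/asboolP.
  by exists (c * d); rewrite ?mulf_neq0 // e e' scalerA.
Qed.

Canonical same_surface_rel (R : realType) :=
  EquivRelPack (same_surface_equiv R).

(* The points of P^19: nonzero cubic forms up to scale. *)
Definition cubic_surface (R : realType) : Type :=
  {eq_quot (same_surface_rel R)}.

(* An equation of X, well defined up to a nonzero scalar (equation_pi). *)
Definition equation (R : realType) (X : cubic_surface R) : {mpoly R[i][4]} :=
  val (repr X).

Lemma equation_pi (R : realType) (f : cubic_form R) :
  exists2 c : R[i], c != 0 & equation (\pi_(cubic_surface R) f) = c *: val f.
Proof.
have /eqmodP/asboolP[c c0 e] :
  repr (\pi_(cubic_surface R) f) = f %[mod cubic_surface R] by rewrite reprK.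
by exists c.
Qed.

(* The 20 monomials of degree 3 in 4 variables; their coefficients are the
   homogeneous coordinates on P^19. *)
Definition cubic_monomials : seq 'X_{1..4} :=
  [seq s2m (val t) | t : 3.-tuple 'I_4 <- enum (basis 4 3)].

Definition cubic_monomial (i : 'I_20) : 'X_{1..4} :=
  nth 0%MM cubic_monomials i.

Lemma size_cubic_monomials : size cubic_monomials = 20%N.
Proof. exact: (size_basis 3 3). Qed.

Lemma cubic_monomial_inj : injective cubic_monomial.
Proof.
move=> i j /eqP; rewrite nth_uniq ?size_cubic_monomials ?uniq_basis //.
by move=> /eqP/val_inj.
Qed.

Lemma cubic_monomialP (m : 'X_{1..4}) :
  reflect (exists i, m = cubic_monomial i) (mdeg m == 3%N).
Proof.
rewrite basis_cover -/cubic_monomials; apply: (iffP idP) => [mb|[i ->]]; last first.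
  by rewrite mem_nth ?size_cubic_monomials.
have lt : (index m cubic_monomials < 20)%N.
  by rewrite -size_cubic_monomials index_mem.
by exists (Ordinal lt); rewrite /cubic_monomial /= nth_index.
Qed.

Definition coordinates (R : realType) (X : cubic_surface R) : 'I_20 -> R[i] :=
  fun i => (equation X)@_(cubic_monomial i).

Definition zariski_closed (R : realType) (Z : set (cubic_surface R)) : Prop :=
  exists S : set {mpoly R[i][20]},
    (forall G, S G -> exists d : nat, G \is d.-homog) /\
    (forall X, Z X <-> forall G, S G -> G.@[coordinates X] = 0).

Definition zariski_open (R : realType) (O : set (cubic_surface R)) : Prop :=
  zariski_closed (~` O).

Definition zariski_open_in (R : realType) (D U : set (cubic_surface R)) : Prop :=
  exists2 O, zariski_open O & U = D `&` O.

Definition zariski_dense_in (R : realType) (D U : set (cubic_surface R)) : Prop :=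
  forall O, zariski_open O -> D `&` O !=set0 -> U `&` O !=set0.

Definition singular_form (R : realType) (f : {mpoly R[i][4]}) : Prop :=
  exists2 p : 'I_4 -> R[i], (exists i, p i != 0) &
    forall i : 'I_4, (f^`M(i)).@[p] = 0.

Definition discriminant (R : realType) : set (cubic_surface R) :=
  [set X | singular_form (equation X)].

Definition sum_of_cubes (R : realType) (f : {mpoly R[i][4]}) (r : nat) : Prop :=
  exists2 l : 'I_r -> {mpoly R[i][4]}, (forall i, l i \is 1.-homog) &
    f = \sum_(i < r) l i ^+ 3.

Definition has_rank (R : realType) (f : {mpoly R[i][4]}) (r : nat) : Prop :=
  sum_of_cubes f r /\ forall s : nat, sum_of_cubes f s -> (r <= s)%N.

(* Singularity and rank do not depend on the choice of an equation. *)
Lemma singular_formZ (R : realType) (f : {mpoly R[i][4]}) (c : R[i]) :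
  c != 0 -> singular_form (c *: f) <-> singular_form f.
Proof.
by move=> c0; split=> -[p pn0 h]; exists p => // i; move: (h i);
   rewrite mderivZ mevalZ; last (by move=> ->; rewrite mulr0);
   move=> /eqP; rewrite mulf_eq0 (negPf c0) => /eqP.
Qed.

Lemma sum_of_cubesZ (R : realType) (f : {mpoly R[i][4]}) (c : R[i]) (r : nat) :
  sum_of_cubes f r -> sum_of_cubes (c *: f) r.
Proof.
move=> [l l1 ->].
have [d dc] : exists d : R[i], d ^+ 3 = c.
  by exists (3.-root c); rewrite rootCK.
exists (fun i => d *: l i) => [i|]; first exact: dhomogZ.
by rewrite scaler_sumr; apply: eq_bigr => i _; rewrite exprZn dc.
Qed.

Lemma has_rankZ (R : realType) (f : {mpoly R[i][4]}) (c : R[i]) (r : nat) :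
  c != 0 -> has_rank (c *: f) r <-> has_rank f r.
Proof.
have H (g : {mpoly R[i][4]}) (d : R[i]) :
    d != 0 -> has_rank g r -> has_rank (d *: g) r.
  move=> d0 [gr gmin]; split=> [|s /(sum_of_cubesZ d^-1)].
    exact: sum_of_cubesZ.
  by rewrite scalerA mulVf // scale1r => /gmin.
move=> c0; split; last exact: H.
by move=> /(H _ _ (invr_neq0 c0)); rewrite scalerA mulVf // scale1r.
Qed.

(* Main.v *)
From HB Require Import structures.
Require Import Defs.
From mathcomp Require Import all_boot all_order all_algebra all_field.
From mathcomp Require Import complex mpoly boolp classical_sets reals.
From mathcomp Require Import ring.

(** Fix a point p of P^3. In Sylvester's pentahedral form
    a_0 y_0^3 + ... + a_4 y_4^3, where the y_i are linear forms with sum 0 of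
    which four are independent, the surface is singular at p exactly when the
    numbers a_i y_i(p)^2 are all equal. With b_i = y_i(p) nonzero this leaves,
    up to scale, a_i = prod_(j != i) b_j^2: this is [pent], a family of singular
    cubics which are visibly sums of five cubes. Three facts give the theorem.

    The members of the family are not sums of four cubes ([pent_not_cubes4]). A
    singular sum of four cubes is a cone: if its four linear forms are
    independent it is the Fermat cubic, which is smooth, and otherwise a point
    where all four vanish is a vertex ([singular_cubes4_cone]). A member of the
    family is not a cone, because the squares of five forms whose only linear
    relation is y_0 + ... + y_4 = 0 are linearly independent ([pent_not_cone]).

    The family is dense among the cubics singular at p
    ([admissible_dense_at]). The cubics of the form sum_i y_i^2 u_i fill the
    whole space of cubics ([in_span_cubic]), and a cubic of this form which is
    singular at p is, modulo the family member itself, a tangent vector to the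
    family ([tangent_row_curve]). So if a polynomial G on K^20 vanishes on the
    family, its derivatives in the directions of the cubics singular at p vanish
    on the family too; by induction on the degree they vanish on all cubics
    singular at p, hence G is constant on this linear space, and it is 0 because
    it is 0 on the family. This replaces a dimension count.

    The discriminant is irreducible ([singular_locus_irreducible]): the parameter
    space of the family, p varying, is open in a linear space, so that two of its
    points can be joined by a line, on which a product of two nonzero polynomials
    is nonzero.

    Being a sum of r cubes is a first-order condition on the coefficients, so by
    quantifier elimination over an algebraically closed field it is constant on
    an open dense part of an irreducible set
    ([definable_generically_constant]). For `five cubes, not four' that constant
    must be the value taken on the family, namely true. A homogeneous component
    of the polynomial found in this way defines the open set. *)

Set Implicit Arguments.
Unset Strict Implicit.
Unset Printing Implicit Defensive.

Import GRing.Theory Num.Theory.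
Local Open Scope ring_scope.

(** * Polynomials vanishing at all but finitely many points *)

Section Interpolation.

Variable K : numClosedFieldType.

Lemma poly_nonroot (p : {poly K}) : p != 0 -> exists x, p.[x] != 0.
Proof.
by move=> p0; have [x] := closed_nonrootP p p0; exists x.
Qed.

Lemma poly_eq0_cofinite (p q : {poly K}) :
  q != 0 -> (forall x, q.[x] != 0 -> p.[x] = 0) -> p = 0.
Proof.
move=> q0 h; apply/eqP/negP => /negP p0.
have [x] : exists x, (p * q).[x] != 0 by apply: poly_nonroot; rewrite mulf_neq0.
by rewrite hornerM mulf_eq0 negb_or => /andP[/negP px /h/eqP].
Qed.

Lemma horner_const_deriv (p : {poly K}) (x y : K) :
  (forall t, (p^`()).[t] = 0) -> p.[x] = p.[y].
Proof.
move=> h.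
have /polyP dp : p^`() = 0.
  by apply: (@poly_eq0_cofinite _ 1) => [|t _]; rewrite ?oner_neq0.
suff -> : p = (p`_0)%:P by rewrite !hornerC.
apply/polyP => -[|i]; rewrite coefC //=.
by move: (dp i); rewrite coef_deriv coef0 => /eqP; rewrite mulrn_eq0 => /eqP.
Qed.

End Interpolation.

(** * Restricting a polynomial to a polynomial curve *)

Section Curves.

Variables (K : comNzRingType) (n : nat).
Implicit Types (G : {mpoly K[n]}) (P : 'I_n -> {poly K}).

Lemma horner_mmap G P t : (mmap polyC P G).[t] = G.@[fun j => (P j).[t]].
Proof.
rewrite /mmap horner_sum mevalE; apply: eq_bigr => m _.
rewrite hornerM hornerC /mmap1 horner_prod; congr (_ * _).
by apply: eq_bigr => i _; rewrite horner_exp.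
Qed.

(** The chain rule. *)
Lemma deriv_mmap G P :
  (mmap polyC P G)^`() = \sum_j mmap polyC P G^`M(j) * (P j)^`().
Proof.
have HM A B : (mmap polyC P A)^`() = \sum_j mmap polyC P A^`M(j) * (P j)^`() ->
   (mmap polyC P B)^`() = \sum_j mmap polyC P B^`M(j) * (P j)^`() ->
   (mmap polyC P (A * B))^`() = \sum_j mmap polyC P (A * B)^`M(j) * (P j)^`().
  move=> hA hB; rewrite rmorphM /= derivM hA hB mulr_suml mulr_sumr -big_split.
  by apply: eq_bigr => j _; rewrite mderivM rmorphD !rmorphM /=; ring.
elim/mpolyind: G => [|c m p _ _ ih].
  by rewrite mmap0 deriv0 big1 // => j _; rewrite mderiv0 mmap0 mul0r.
rewrite mmapD derivD ih -mul_mpolyC.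
rewrite [X in X + _](_ : _ = \sum_j mmap polyC P (c%:MP_[n] * 'X_[m])^`M(j) * (P j)^`()).
  rewrite -big_split; apply: eq_bigr => j _.
  by rewrite mderivD mmapD mulrDl.
apply: (HM).
  rewrite mmapC derivC big1 // => j _.
  by rewrite mderivC mmap0 mul0r.
rewrite mpolyXE_id; elim/big_ind: _ => [|A B|i _].
- rewrite -mpolyC1 mmapC derivC big1 // => j _.
  by rewrite mderivC mmap0 mul0r.
- exact: HM.
elim: (m i) => [|k IH].
  rewrite expr0 -mpolyC1 mmapC derivC big1 // => j _.
  by rewrite mderivC mmap0 mul0r.
rewrite exprS; apply: (HM) IH.
rewrite mmapX mmap1U (bigD1 i) //= big1 => [|j ji].
  have -> : U_(i)%MM = (0 + U_(i))%MM :> 'X_{1..n} by rewrite add0m.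
  by rewrite mderivX mnmDE mnm0E mnm1E eqxx scale1r addmK mmapX mmap11 mul1r addr0.
by rewrite mderivX mnm1E eq_sym (negPf ji) scale0r mmap0 mul0r.
Qed.

Lemma msize_mderiv_le G j k : (msize G <= k.+1)%N -> (msize G^`M(j) <= k)%N.
Proof.
move=> h; rewrite msizeE; apply/bigmax_leqP_seq => m.
rewrite mcoeff_msupp mcoeff_deriv => hm _.
have : (m + U_(j))%MM \in msupp G.
  by rewrite mcoeff_msupp; apply: contraNneq hm => ->; rewrite mul0rn.
move=> /msize_mdeg_lt; rewrite mdegD mdeg1 addn1 => h'.
by have := leq_trans h' h.
Qed.

End Curves.

Section CoordinatesAlongCurves.

Variable K : numClosedFieldType.
Implicit Types (f : {mpoly K[4]}) (G : {mpoly K[20]}) (C : {poly {mpoly K[4]}}).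

Definition coordv f : 'I_20 -> K := fun i => f@_(cubic_monomial i).

(** A curve of cubics is a polynomial in the time variable with coefficients in
    the ring of forms, so that derivatives in time and in the coordinates of P^3
    do not interfere. *)
Definition coord_curve C : 'I_20 -> {poly K} :=
  fun i => map_poly (mcoeff (cubic_monomial i)) C.

Definition along G C : {poly K} := mmap polyC (coord_curve C) G.

Definition dir_deriv f G : {mpoly K[20]} := \sum_j coordv f j *: G^`M(j).

Lemma dir_derivE f G x : (dir_deriv f G).@[x] = \sum_j coordv f j * (G^`M(j)).@[x].
Proof. by rewrite raddf_sum; apply: eq_bigr => j _; rewrite /= mevalZ. Qed.

Lemma coord_curve_horner C t j : (coord_curve C j).[t] = coordv C.[t%:MP] j.
Proof.
rewrite /coordv [in RHS]horner_coef raddf_sum /coord_curve.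
rewrite (@horner_coef_wide _ (size C)) ?size_poly //.
apply: eq_bigr => i _ /=; rewrite coef_map_id0 ?mcoeff0 //.
by rewrite -rmorphXn /= [in RHS]mulrC mul_mpolyC mcoeffZ mulrC.
Qed.

Lemma along_horner G C t : (along G C).[t] = G.@[coordv C.[t%:MP]].
Proof.
by rewrite horner_mmap; apply: meval_eq => j; rewrite coord_curve_horner.
Qed.

(** The chain rule once more: the speed of G along C is the derivative of G in
    the direction of the velocity of C. *)
Lemma along_deriv G C t :
  ((along G C)^`()).[t] = (dir_deriv (C^`()).[t%:MP] G).@[coordv C.[t%:MP]].
Proof.
rewrite deriv_mmap horner_sum dir_derivE.
apply: eq_bigr => j _; rewrite hornerM horner_mmap mulrC.
congr (_ * _); last by apply: meval_eq => i; rewrite coord_curve_horner.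
rewrite -coord_curve_horner; congr _.[t].
apply/polyP => i; rewrite coef_deriv !coef_map_id0 ?mcoeff0 //.
by rewrite coef_deriv mcoeffMn.
Qed.

End CoordinatesAlongCurves.

(** * Linear forms as row vectors *)

Section LinearForms.

Variable K : numClosedFieldType.
Implicit Types (c d : 'rV[K]_4) (p : 'cV[K]_4).

Definition pt p : 'I_4 -> K := fun k => p k 0.

Definition lin c : {mpoly K[4]} := \sum_k c 0 k *: 'X_k.

Lemma lin_is_linear : linear lin.
Proof.
move=> a c d; rewrite /lin scaler_sumr -big_split; apply: eq_bigr => k _.
by rewrite !mxE scalerDl scalerA.
Qed.

HB.instance Definition _ :=
  GRing.isLinear.Build K 'rV[K]_4 {mpoly K[4]} _ lin lin_is_linear.

Lemma linD c d : lin (c + d) = lin c + lin d. Proof. exact: raddfD. Qed.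
Lemma linN c : lin (- c) = - lin c. Proof. exact: raddfN. Qed.
Lemma linZ a c : lin (a *: c) = a *: lin c. Proof. exact: linearZ. Qed.

Lemma lin_homog c : lin c \is 1.-homog.
Proof.
by apply: rpred_sum => k _; apply: rpredZ; rewrite dhomogX /= mdeg1.
Qed.

Lemma lin_cube_homog c : lin c ^+ 3 \is 3.-homog.
Proof.
rewrite !exprS expr0 mulr1.
by rewrite (@dhomogM _ _ _ 1 _ 2) ?(@dhomogM _ _ _ 1 _ 1) ?lin_homog.
Qed.

Lemma homog1_lin (l : {mpoly K[4]}) : l \is 1.-homog -> exists c, l = lin c.
Proof.
move=> /dhomogP hl; exists (\row_k l@_U_(k)).
apply/mpolyP => m; rewrite /lin raddf_sum /=.
have E k : (((\row_k l@_U_(k)) 0 k *: 'X_k) : {mpoly K[4]})@_m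
    = l@_U_(k) * (U_(k)%MM == m)%:R by rewrite mcoeffZ mxE mcoeffX.
under eq_bigr do rewrite E.
have [/eqP/mdeg1P[k /eqP ->]|m1] := eqVneq (mdeg m) 1%N.
  rewrite (bigD1 k) //= eqxx mulr1 big1 ?addr0 // => j jk.
  case: eqP => [/mnmP/(_ j)|]; rewrite ?mulr0 //.
  by rewrite !mnm1E eqxx eq_sym (negPf jk).
rewrite big1 => [|k _].
  by apply/memN_msupp_eq0/negP => /hl /= e; rewrite e in m1.
by case: eqP => [e|]; rewrite ?mulr0 //; rewrite -e mdeg1 in m1.
Qed.

Lemma lin_eval c p : (lin c).@[pt p] = (c *m p) 0 0.
Proof.
by rewrite raddf_sum mxE; apply: eq_bigr => k _; rewrite /= mevalZ mevalXU.
Qed.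

Lemma lin_deriv c k : (lin c)^`M(k) = (c 0 k)%:MP.
Proof.
rewrite raddf_sum (bigD1 k) //= big1 ?addr0 => [|j jk].
  have -> : U_(k)%MM = (0 + U_(k))%MM :> 'X_{1..4} by rewrite add0m.
  rewrite mderivZ mderivX mnmDE mnm0E mnm1E eqxx scale1r addmK mpolyX0.
  by rewrite -mul_mpolyC mulr1.
by rewrite mderivZ mderivX mnm1E (negPf jk) scale0r scaler0.
Qed.

End LinearForms.

(** * Cubics spanned by the squares of five linear forms *)

Section Pentahedron.

Variable K : numClosedFieldType.
Implicit Types (Y U Z : 'M[K]_(5, 4)) (p : 'cV[K]_4) (b : 'cV[K]_5).

Definition face Y i : {mpoly K[4]} := lin (row i Y).

Lemma face_eval Y i p : (face Y i).@[pt p] = (Y *m p) i 0.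
Proof. by rewrite lin_eval -row_mul mxE. Qed.

Lemma face_deriv Y i k : (face Y i)^`M(k) = (Y i k)%:MP.
Proof. by rewrite lin_deriv mxE. Qed.

Lemma faceD Y Z i : face (Y + Z) i = face Y i + face Z i.
Proof. by rewrite /face !raddfD. Qed.

Lemma faceZ a Y i : face (a *: Y) i = a *: face Y i.
Proof. by rewrite /face !linearZ. Qed.

Lemma face_sum Y : const_mx 1 *m Y = 0 :> 'rV_4 -> \sum_i face Y i = 0.
Proof.
move=> h; rewrite /face -raddf_sum /= (_ : \sum_i _ = 0) ?raddf0 //.
apply/rowP => j; rewrite summxE mxE.
have := congr1 (fun A : 'rV_4 => A 0 j) h; rewrite !mxE => {2}<-.
by apply: eq_bigr => i _; rewrite !mxE mul1r.
Qed.

(** The sums of y_i^2 u_i are the tangent directions at a sum of cubes of the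
    y_i, when the y_i vary freely. *)
Definition in_span Y g := exists U, g = \sum_i face Y i ^+ 2 * face U i.

Lemma in_span0 Y : in_span Y 0.
Proof.
by exists 0; rewrite big1 // => i _; rewrite /face !raddf0 mulr0.
Qed.

Lemma in_spanD Y g h : in_span Y g -> in_span Y h -> in_span Y (g + h).
Proof.
move=> [U ->] [V ->]; exists (U + V); rewrite -big_split.
by apply: eq_bigr => i _; rewrite faceD mulrDr.
Qed.

Lemma in_spanZ Y a g : in_span Y g -> in_span Y (a *: g).
Proof.
move=> [U ->]; exists (a *: U); rewrite scaler_sumr.
by apply: eq_bigr => i _; rewrite faceZ scalerAr.
Qed.

Lemma in_span_sum Y (I : Type) (r : seq I) (P : pred I) (g : I -> {mpoly K[4]}) :
  (forall i, P i -> in_span Y (g i)) -> in_span Y (\sum_(i <- r | P i) g i).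
Proof.
move=> h; elim/big_ind: _ => //; [exact: in_span0|exact: in_spanD].
Qed.

Lemma in_span_square Y i c : in_span Y (face Y i ^+ 2 * lin c).
Proof.
pose U : 'M[K]_(5, 4) := \matrix_(j, k) (c 0 k *+ (j == i)); exists U.
rewrite (bigD1 i) //= big1 => [|j ji].
  rewrite addr0; congr (_ * lin _); apply/rowP => k.
  by rewrite !mxE eqxx.
rewrite /face (_ : row j U = 0) ?raddf0 ?mulr0 //.
by apply/rowP => k; rewrite !mxE (negPf ji).
Qed.

(** Modulo the multiples of u^2, v^2, w^2 and x^2, the square of
    s = u + v + w + x is 2 (uv + uw + ux + vw + vx + wx). Multiplying it by
    u + v + w - 2x kills the products u v x, u w x, v w x, each of which
    occurs 2 + 2 - 4 = 0 times, and leaves 6 u v w. *)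
Lemma mixed_product_identity (R : comNzRingType) (u v w x : R) :
  (u + v + w + x) ^+ 2 * (u + v + w - x *+ 2) =
    (u * v * w) *+ 6
  + u ^+ 2 * (u + v *+ 3 + w *+ 3)
  + v ^+ 2 * (v + u *+ 3 + w *+ 3)
  + w ^+ 2 * (w + u *+ 3 + v *+ 3)
  + x ^+ 2 * (- x *+ 2 - (u + v + w) *+ 3).
Proof. ring. Qed.

(** With the fifth form equal to minus the sum of the four others, even a product
    of three distinct forms is a combination of squares times linear forms. *)
Lemma in_span_mixed Y (a b c d : 'rV[K]_4) :
  (forall e, in_span Y (lin a ^+ 2 * lin e)) ->
  (forall e, in_span Y (lin b ^+ 2 * lin e)) ->
  (forall e, in_span Y (lin c ^+ 2 * lin e)) ->
  (forall e, in_span Y (lin d ^+ 2 * lin e)) ->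
  (forall e, in_span Y (lin (a + b + c + d) ^+ 2 * lin e)) ->
  in_span Y (lin a * lin b * lin c).
Proof.
move=> ha hb hc hd hs.
have -> : lin a * lin b * lin c = 6^-1 *:
   (lin (a + b + c + d) ^+ 2 * lin (a + b + c - 2 *: d)
  + (-1) *: (lin a ^+ 2 * lin (a + 3 *: b + 3 *: c))
  + (-1) *: (lin b ^+ 2 * lin (b + 3 *: a + 3 *: c))
  + (-1) *: (lin c ^+ 2 * lin (c + 3 *: a + 3 *: b))
  + (-1) *: (lin d ^+ 2 * lin (- (2 *: d) - 3 *: (a + b + c)))).
  rewrite !(linZ, linD, linN) !scaler_nat mixed_product_identity !scaleN1r.
  apply: (@scalerI _ _ 6); first by rewrite pnatr_eq0.
  by rewrite scalerA mulfV ?pnatr_eq0 // scale1r scaler_nat; ring.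
by apply: in_spanZ; do ?[apply: in_spanD => //]; apply: in_spanZ.
Qed.

(** The coordinate matrix of the first four forms. *)
Definition base_mx Y : 'M[K]_4 := \matrix_(i, j) Y (lift ord_max i) j.

Lemma in_span_face3 Y (i j k : 'I_4) : const_mx 1 *m Y = 0 :> 'rV_4 ->
  in_span Y (face Y (lift ord_max i) * face Y (lift ord_max j)
             * face Y (lift ord_max k)).
Proof.
move=> Y0; pose y (a : 'I_4) := row (lift ord_max a) Y.
rewrite -[face _ _]/(lin (y i)) -[face _ (_ j)]/(lin (y j)).
rewrite -[face _ (_ k)]/(lin (y k)).
have sq a c : in_span Y (lin (y a) ^+ 2 * lin c) by exact: in_span_square.
have [-> | ij] := eqVneq i j; first by rewrite -expr2; apply: sq.
have [-> | ik] := eqVneq i k; first by rewrite mulrAC -expr2; apply: sq.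
have [-> | jk] := eqVneq j k; first by rewrite -mulrA mulrC -expr2; apply: sq.
have [l] : exists l, l \notin [:: i; j; k].
  apply/existsP; rewrite -negb_forall; apply/negP => /forallP h.
  have : (#|'I_4| <= #|[:: i; j; k]|)%N.
    by apply/subset_leq_card/fintype.subsetP => a _; exact: h.
  by rewrite card_ord => /leq_trans/(_ (card_size _)).
rewrite !inE !negb_or => /and3P[li lj lk].
apply: (@in_span_mixed _ _ _ _ (y l)) => // e.
have -> : lin (y i + y j + y k + y l) = - face Y ord_max; last first.
  by rewrite sqrrN; exact: in_span_square.
apply/eqP; rewrite -addr_eq0 addrC -(face_sum Y0) (bigD1_ord ord_max) //.
rewrite (inj_eq (addrI _)) /= -[X in _ == X]/(\sum_(a < 4) lin (y a)).
rewrite (bigD1 l) //= (bigD1 i) 1?eq_sym //= (bigD1 j) /=; last first.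
  by rewrite eq_sym lj eq_sym ij.
rewrite (bigD1 k) /=; last by rewrite !(eq_sym k) lk ik jk.
rewrite big1 => [|a /andP[/andP[/andP[al ai] aj] ak]].
  rewrite !raddfD /=; apply/eqP; ring.
have : (#|[:: a; i; j; k; l]| <= #|'I_4|)%N.
  by apply/subset_leq_card/fintype.subsetP.
rewrite card_ord (card_uniqP _) //= !inE !negb_or al ai aj ak ij ik jk.
by rewrite !(eq_sym _ l) li lj lk.
Qed.

Lemma var_face Y k : base_mx Y \in unitmx ->
  'X_k = \sum_a invmx (base_mx Y) k a *: face Y (lift ord_max a).
Proof.
move=> uY.
have -> : 'X_k = lin (delta_mx 0 k) :> {mpoly K[4]}.
  rewrite /lin (bigD1 k) //= !mxE !eqxx scale1r big1 ?addr0 // => j jk.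
  by rewrite mxE (negPf jk) andbF scale0r.
rewrite -(mulmx1 (delta_mx 0 k)) -(mulVmx uY) mulmxA -rowE.
rewrite mulmx_sum_row raddf_sum; apply: eq_bigr => a _ /=.
rewrite linearZ mxE; congr (_ *: lin _).
by apply/rowP => j; rewrite !mxE.
Qed.

(** The first four forms are a system of coordinates, so the cubics are spanned by
    triple products of these, which [in_span_face3] treats. *)
Lemma in_span_cubic Y g :
  const_mx 1 *m Y = 0 :> 'rV_4 -> base_mx Y \in unitmx ->
  g \is 3.-homog -> in_span Y g.
Proof.
move=> Y0 uY /dhomogP hg; rewrite [g]mpolyE big_seq.
apply: in_span_sum => m /hg /= m3; apply: in_spanZ.
have split_var d (n : 'X_{1..4}) : mdeg n = d.+1 ->
    exists i n', mdeg n' = d /\ 'X_[n] = 'X_i * 'X_[n'] :> {mpoly K[4]}.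
  move=> nd; have [i ni] : exists i, n i != 0%N.
    apply/existsP; rewrite -negb_forall; apply/negP => /forallP h.
    have n0 : n = 0%MM by apply/mnmP => i; rewrite mnm0E; apply/eqP.
    by rewrite n0 mdeg0 in nd.
  have le : (U_(i) <= n)%MM.
    by apply/mnm_lepP => j; rewrite mnm1E; case: eqP => // <-; rewrite lt0n.
  exists i, (n - U_(i))%MM; rewrite -mpolyXD addmC submK //; split=> //.
  by move: nd; rewrite -{1}(submK le) mdegD mdeg1 addn1 => -[].
have {split_var} [i [j [k ->]]] :
    exists i j k, 'X_[m] = 'X_i * 'X_j * 'X_k :> {mpoly K[4]}.
  have [i [n1 [/split_var[j [n2 [/split_var[k [n3 [/eqP]]]]]]]]] := split_var _ _ m3.
  rewrite mdeg_eq0 => /eqP -> -> -> ->; exists i, j, k.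
  by rewrite mpolyX0 mulr1 mulrA.
have expand q r : (forall a, in_span Y (face Y (lift ord_max a) * q)) ->
    in_span Y ('X_r * q).
  move=> h; rewrite (var_face r uY) mulr_suml; apply: in_span_sum => a _.
  by rewrite -scalerAl; apply: in_spanZ.
rewrite -mulrA; apply: (expand) => a; rewrite mulrCA; apply: (expand) => b.
rewrite mulrCA mulrA mulrC; apply: expand => c.
by rewrite mulrC; exact: in_span_face3.
Qed.

End Pentahedron.

(** * The pentahedral family and its tangent vectors *)

Section Family.

Variable K : numClosedFieldType.
Implicit Types (Y U Z : 'M[K]_(5, 4)) (p : 'cV[K]_4) (b w : 'cV[K]_5).
Implicit Types (G : {mpoly K[20]}).

(** Stated for matrices with any number of columns, to serve both for the forms
    and for their values at a point. *)
Definition sum0 m (Y : 'M[K]_(5, m)) := const_mx 1 *m Y = 0 :> 'rV_m.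

(** The denominators of prod_j b_j / b_i are cleared: this is polynomial in b. *)
Definition cofactor_prod b i := \prod_(j | j != i) b j 0.

(** Here b stands for the values of the forms at the singular point; keeping it
    independent of Y makes the parameter space a linear one. *)
Definition pent Y b : {mpoly K[4]} :=
  \sum_i cofactor_prod b i ^+ 2 *: face Y i ^+ 3.

Definition admissible Y b :=
  [/\ sum0 Y, sum0 b, forall i, b i 0 != 0 & base_mx Y \in unitmx].

Lemma sum0_line m (Y Z : 'M[K]_(5, m)) t : sum0 Y -> sum0 Z -> sum0 (Y + t *: Z).
Proof. by rewrite /sum0 => Y0 Z0; rewrite mulmxDr -scalemxAr Y0 Z0 scaler0 addr0. Qed.

(** Being admissible is an open condition, so on a line through an admissible
    parameter it holds wherever a certain nonzero polynomial does not vanish. *)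
Lemma admissible_line Y b Z w : admissible Y b -> sum0 Z -> sum0 w ->
  exists2 N : {poly K}, N != 0 &
    forall t, N.[t] != 0 -> admissible (Y + t *: Z) (b + t *: w).
Proof.
move=> [Y0 b0 bn uY] Z0 w0.
pose M : 'M[{poly K}]_4 := \matrix_(i, j)
   ((base_mx Y i j)%:P + (base_mx Z i j)%:P * 'X).
pose N := \det M * \prod_j ((b j 0)%:P + (w j 0)%:P * 'X).
have NE t : N.[t] = \det (base_mx (Y + t *: Z)) * \prod_j (b + t *: w) j 0.
  rewrite hornerM horner_prod; congr (_ * _).
    rewrite -[LHS]/(horner_eval t _) -det_map_mx; congr (\det _).
    by apply/matrixP => i j; rewrite !mxE /= /horner_eval !hornerE mulrC.
  by apply: eq_bigr => j _; rewrite !mxE !hornerE mulrC.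
exists N => [|t].
  apply/negP => /eqP N0; have := NE 0; rewrite N0 horner0 !scale0r !addr0.
  move/esym/eqP; rewrite mulf_eq0 => /orP[|/prodf_eq0[j _]].
    by move: uY; rewrite unitmxE unitfE => /negPf ->.
  by rewrite (negPf (bn j)).
rewrite NE mulf_eq0 negb_or => /andP[dn /prodf_neq0 pn].
split; [exact: sum0_line|exact: sum0_line|by move=> i; exact: pn|].
by rewrite unitmxE unitfE.
Qed.

(** [cofactor_prod] along a line when P is j != i; the whole product when P holds
    everywhere. *)
Definition prod_curve b w (P : pred 'I_5) : {poly K} :=
  \prod_(j | P j) ((b j 0)%:P + (w j 0)%:P * 'X).

Definition pent_curve Y b Z w : {poly {mpoly K[4]}} :=
  \sum_i map_poly (@mpolyC 4 K) (prod_curve b w (fun j => j != i)) ^+ 2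
         * ((face Y i)%:P + (face Z i)%:P * 'X) ^+ 3.

Lemma prod_curve_horner b w P t :
  (prod_curve b w P).[t] = \prod_(j | P j) (b + t *: w) j 0.
Proof.
by rewrite horner_prod; apply: eq_bigr => j _; rewrite !mxE !hornerE mulrC.
Qed.

Lemma pent_curve_horner Y b Z w t :
  (pent_curve Y b Z w).[t%:MP] = pent (Y + t *: Z) (b + t *: w).
Proof.
rewrite horner_sum; apply: eq_bigr => i _.
rewrite hornerM !horner_exp horner_map prod_curve_horner /=.
rewrite hornerD hornerM !hornerC hornerX -mul_mpolyC rmorphXn.
by rewrite faceD faceZ -(mul_mpolyC t) [t%:MP * _]mulrC.
Qed.

Lemma pent_curve_horner0 Y b Z w : (pent_curve Y b Z w).[0%:MP] = pent Y b.
Proof. by rewrite pent_curve_horner !scale0r !addr0. Qed.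

(** Writing b = Y p, the velocity z_i = b_i^2 u_i + 2 b_i u_i(p) y_i is the one
    for which the family moves in the direction sum_i y_i^2 u_i, up to a multiple
    of the family member. The first term alone would produce this direction from
    the cubes; the second offsets the motion of the coefficients, which depend
    on y_i(p). *)
Definition tangent_row Y U p : 'M[K]_(5, 4) :=
  let b := Y *m p in let u := U *m p in
  \matrix_(i, k) (b i 0 ^+ 2 * U i k + (b i 0 * u i 0 * Y i k) *+ 2).

Lemma tangent_row_value Y U p i :
  (tangent_row Y U p *m p) i 0 = ((Y *m p) i 0 ^+ 2 * (U *m p) i 0) *+ 3.
Proof.
have E : (tangent_row Y U p *m p) i 0 =
    (Y *m p) i 0 ^+ 2 * (U *m p) i 0
    + ((Y *m p) i 0 * (U *m p) i 0 * (Y *m p) i 0) *+ 2.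
  rewrite [LHS]mxE; under eq_bigr do rewrite mxE mulrDl mulrnAl.
  rewrite big_split /= sumrMnl [in X in _ = _ * X + _]mxE [X in _ = _ + _ * X *+ 2]mxE.
  by rewrite !mulr_sumr; congr (_ + _ *+ 2); apply: eq_bigr => k _; rewrite mulrA.
by rewrite E; ring.
Qed.

Lemma face_tangent_row Y U p i :
  face (tangent_row Y U p) i = ((Y *m p) i 0 ^+ 2)%:MP * face U i
    + ((Y *m p) i 0 * (U *m p) i 0)%:MP * face Y i *+ 2.
Proof.
have -> : face (tangent_row Y U p) i
    = lin ((Y *m p) i 0 ^+ 2 *: row i U
           + ((Y *m p) i 0 * (U *m p) i 0) *: row i Y *+ 2).
  by congr lin; apply/rowP => k; rewrite !mxE.
by rewrite linD -scaler_nat !linZ scaler_nat !mul_mpolyC.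
Qed.

(** Let B be the product of the b_i, A_i = B / b_i, and w_i = z_i(p), which is
    3 b_i^2 u_i(p). The derivative of A_i^2 y_i^3 is
    3 A_i^2 y_i^2 z_i + 2 A_i A_i' y_i^3. After multiplication by B, the first
    term becomes 3 B^3 y_i^2 u_i + 6 A_i^3 b_i^2 u_i(p) y_i^3. In the second,
    b_i A_i' = B' - w_i A_i turns it into
    2 B' A_i^2 y_i^3 - 6 A_i^3 b_i^2 u_i(p) y_i^3, and the last terms cancel. *)
Lemma tangent_row_curve Y U p (b := Y *m p) (Z := tangent_row Y U p) :
  exists c : K,
  (\prod_j b j 0) *: (pent_curve Y b Z (Z *m p))^`().[0%:MP]
   = c *: pent Y b + ((\prod_j b j 0) ^+ 3 *+ 3) *: \sum_i face Y i ^+ 2 * face U i.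
Proof.
pose w := Z *m p; pose B := prod_curve b w predT.
pose A i := prod_curve b w (fun j => j != i).
have BA i : B = ((b i 0)%:P + (w i 0)%:P * 'X) * A i.
  by rewrite /B /prod_curve (bigD1 i).
have A0 i : (A i).[0] = cofactor_prod b i.
  by rewrite prod_curve_horner scale0r addr0.
have B0 : B.[0] = \prod_j b j 0 by rewrite prod_curve_horner scale0r addr0.
have bA i : \prod_j b j 0 = b i 0 * cofactor_prod b i by rewrite (bigD1 i).
exists ((B^`()).[0] *+ 2).
rewrite -!mul_mpolyC /pent_curve raddf_sum horner_sum !mulr_sumr -big_split.
apply: eq_bigr => i _ /=.
rewrite -/w -/(A i) derivM !derivE deriv_map.
rewrite !(hornerD, hornerM, horner_exp, hornerC, hornerX, horner_map).
rewrite -!/(A i) A0 (BA i) derivM !derivE.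
rewrite !(hornerD, hornerM, horner_exp, hornerC, hornerX) A0.
rewrite (bA i) face_tangent_row tangent_row_value -mul_mpolyC -/b /=.
ring.
Qed.

End Family.

(** * Density of the family among the cubics singular at a point *)

Section Density.

Variable K : numClosedFieldType.
Implicit Types (Y U Z : 'M[K]_(5, 4)) (p : 'cV[K]_4) (b w : 'cV[K]_5).
Implicit Types (G : {mpoly K[20]}) (f g : {mpoly K[4]}).

Definition singular_at p f := forall k, (f^`M(k)).@[pt p] = 0.

Lemma singular_atD p f g : singular_at p f -> singular_at p g -> singular_at p (f + g).
Proof. by move=> hf hg k; rewrite mderivD mevalD hf hg addr0. Qed.

Lemma singular_atZ p a f : singular_at p f -> singular_at p (a *: f).
Proof. by move=> hf k; rewrite mderivZ mevalZ hf mulr0. Qed.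

Lemma sum0P m (Y : 'M[K]_(5, m)) : sum0 Y <-> forall k, \sum_i Y i k = 0.
Proof.
split=> [h k|h]; last first.
  by apply/rowP => k; rewrite !mxE -[RHS](h k); apply: eq_bigr => i _;
     rewrite !mxE mul1r.
have := congr1 (fun A : 'rV_m => A 0 k) h; rewrite !mxE => {2}<-.
by apply: eq_bigr => i _; rewrite !mxE mul1r.
Qed.

Lemma sum0_mul Y p : sum0 Y -> sum0 (Y *m p).
Proof. by rewrite /sum0 mulmxA => ->; rewrite mul0mx. Qed.

Lemma pent_homog Y b : pent Y b \is 3.-homog.
Proof.
by apply: rpred_sum => i _; apply: rpredZ; apply: lin_cube_homog.
Qed.

Lemma pent_deriv Y b k : (pent Y b)^`M(k) =
  \sum_i (cofactor_prod b i ^+ 2 * Y i k *+ 3)%:MP * face Y i ^+ 2.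
Proof.
rewrite raddf_sum; apply: eq_bigr => i _ /=.
rewrite mderivZ !exprS expr0 !mulr1 !mderivM face_deriv -mul_mpolyC; ring.
Qed.

(** At p each square contributes A_i^2 b_i^2 = B^2, independent of i, so the
    partial derivatives are multiples of those of the sum of the forms. *)
Lemma pent_singular Y p : sum0 Y -> singular_at p (pent Y (Y *m p)).
Proof.
move=> /sum0P Y0 k; rewrite pent_deriv raddf_sum /=; set b := Y *m p.
transitivity (\sum_i (\prod_j b j 0) ^+ 2 *+ 3 * Y i k).
  apply: eq_bigr => i _; rewrite expr2 !mevalM mevalC face_eval -/b.
  by rewrite [in RHS](bigD1 i) //= -/(cofactor_prod b i); ring.
by rewrite -mulr_sumr Y0 mulr0.
Qed.

(** The k-th column sum of the velocities is literally the k-th partial derivative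
    at p: the linear relation among the forms is preserved to first order exactly
    because the target direction is singular at p. *)
Lemma span_singular Y U p :
  singular_at p (\sum_i face Y i ^+ 2 * face U i) -> sum0 (tangent_row Y U p).
Proof.
move=> h; apply/sum0P => k; rewrite -[RHS](h k) (raddf_sum (mderiv k)) (raddf_sum (meval (pt p))) /=.
apply: eq_bigr => i _; rewrite expr2 !mderivM !face_deriv !mevalD !mevalM.
by rewrite !mevalD !mevalM !mevalC !face_eval !mxE; ring.
Qed.

Lemma mul_base_mx Y p : base_mx Y *m p = \col_i (Y *m p) (lift ord_max i) 0.
Proof. by apply/colP => i; rewrite !mxE; apply: eq_bigr => k _; rewrite mxE. Qed.

(** Coordinates are chosen in which p is (1, 1, 1, 1); the forms are these
    coordinates and minus their sum, so that the values at p are 1 four times,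
    and -4. *)
Lemma exists_admissible p : p != 0 -> exists Y, admissible Y (Y *m p).
Proof.
move=> p0.
have [M uM Mp] : exists2 M : 'M[K]_4, M \in unitmx & M *m p = const_mx 1.
  have [k pk] : exists k, p k 0 != 0.
    apply/existsP; rewrite -negb_forall; apply: contra p0 => /forallP h.
    by apply/eqP/colP => k; rewrite mxE; apply/eqP.
  pose f : 'M[K]_4 := \matrix_(i, j) ((p k 0)^-1 *+ (i == k)).
  have pf : p^T *m f = const_mx 1.
    apply/rowP => j; rewrite !mxE (bigD1 k) //= big1 ?addr0 => [|i ik].
      by rewrite !mxE eqxx mulfV.
    by rewrite !mxE (negPf ik) mulr0.
  have rk (v : 'rV[K]_4) : v != 0 -> \rank v = 1%N by move=> v0; rewrite rank_rV v0.
  have [|g ug e] := @complete_unitmx _ 1 4 p^T f.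
    rewrite !rk ?trmx_eq0 // pf; apply/negP => /eqP/rowP/(_ 0).
    by rewrite !mxE => /eqP; rewrite oner_eq0.
  exists g^T; first by rewrite unitmx_tr.
  by rewrite -[LHS]trmxK trmx_mul trmxK -e pf trmx_const.
pose Y : 'M[K]_(5, 4) := \matrix_(i, j)
  if unlift ord_max i is Some a then M a j else - \sum_a M a j.
have YM : base_mx Y = M by apply/matrixP => i j; rewrite !mxE liftK.
have Y0 : sum0 Y.
  apply/sum0P => k; rewrite (bigD1_ord ord_max) //= !mxE unlift_none.
  by rewrite addrC; apply/eqP; rewrite subr_eq0; apply/eqP/eq_bigr => i _;
     rewrite mxE liftK.
exists Y; split; rewrite ?YM //; first exact: sum0_mul.
have lifted a : (Y *m p) (lift ord_max a) 0 = 1.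
  by move: (mul_base_mx Y p); rewrite YM Mp => /colP/(_ a); rewrite !mxE.
move=> i; case: (unliftP ord_max i) => [a ->|->]; first by rewrite lifted oner_neq0.
have /sum0P/(_ 0) := sum0_mul p Y0; rewrite (bigD1_ord ord_max) //=.
under eq_bigr do rewrite lifted.
rewrite sumr_const card_ord => /eqP; rewrite addr_eq0 => /eqP ->.
by rewrite oppr_eq0 pnatr_eq0.
Qed.

Lemma cofactor_prodZ s b i : cofactor_prod (s *: b) i = s ^+ 4 * cofactor_prod b i.
Proof.
rewrite /cofactor_prod; under eq_bigr do rewrite mxE.
rewrite big_split /= prodr_const; congr (s ^+ _ * _).
by rewrite (@eq_card _ _ (predC1 i)) // cardC1 card_ord.
Qed.

(** The degree is 2 * 4 + 3. *)
Lemma pentZ s Y b : pent (s *: Y) (s *: b) = s ^+ 11 *: pent Y b.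
Proof.
rewrite scaler_sumr; apply: eq_bigr => i _.
by rewrite cofactor_prodZ faceZ exprZn !scalerA; congr (_ *: _); ring.
Qed.

Lemma admissibleZ s Y b : s != 0 -> admissible Y b -> admissible (s *: Y) (s *: b).
Proof.
move=> s0 [Y0 b0 bn uY]; split.
- by rewrite /sum0 -scalemxAr Y0 scaler0.
- by rewrite /sum0 -scalemxAr b0 scaler0.
- by move=> i; rewrite mxE mulf_neq0.
have -> : base_mx (s *: Y) = s *: base_mx Y by apply/matrixP => i j; rewrite !mxE.
by rewrite unitmxZ ?unitfE.
Qed.

(** A curve lying in the zero set of G except perhaps at finitely many times has
    its velocity in the kernel of dG at all times, the exceptional ones included. *)
Lemma along_eq0_deriv G (C : {poly {mpoly K[4]}}) (N : {poly K}) :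
  N != 0 -> (forall t, N.[t] != 0 -> G.@[coordv C.[t%:MP]] = 0) ->
  forall t, (dir_deriv (C^`()).[t%:MP] G).@[coordv C.[t%:MP]] = 0.
Proof.
move=> N0 h t; rewrite -along_deriv (@poly_eq0_cofinite _ (along G C) N) ?deriv0 ?horner0 //.
by move=> x /h; rewrite along_horner.
Qed.

Lemma dir_derivD f g G : dir_deriv (f + g) G = dir_deriv f G + dir_deriv g G.
Proof.
rewrite /dir_deriv -big_split; apply: eq_bigr => j _ /=.
by rewrite /coordv mcoeffD scalerDl.
Qed.

Lemma dir_derivZ a f G : dir_deriv (a *: f) G = a *: dir_deriv f G.
Proof.
rewrite /dir_deriv scaler_sumr; apply: eq_bigr => j _ /=.
by rewrite /coordv mcoeffZ scalerA.
Qed.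

(** The induction step for density: the derivative of G in the direction of a
    cubic v singular at p inherits the vanishing of G on the family. *)
Lemma dir_deriv_vanishes_at_admissible p G :
  (forall Y, admissible Y (Y *m p) -> G.@[coordv (pent Y (Y *m p))] = 0) ->
  forall v Y, v \is 3.-homog -> singular_at p v -> admissible Y (Y *m p) ->
  (dir_deriv v G).@[coordv (pent Y (Y *m p))] = 0.
Proof.
move=> Gv v Y v3 vs gY; have [Y0 b0 bn uY] := gY.
have [U vE] := in_span_cubic Y0 uY v3.
pose Z := tangent_row Y U p; set f := pent _ _.
have Z0 : sum0 Z by apply: span_singular; rewrite -vE.
(* The multiples t f all belong to the family, up to an 11th root of t, which
   disposes of the multiple of f in the tangent vector. *)
have radial : (dir_deriv f G).@[coordv f] = 0.
  pose C : {poly {mpoly K[4]}} := f%:P * 'X.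
  have CE t : C.[t%:MP] = t *: f by rewrite hornerM hornerC hornerX mulrC mul_mpolyC.
  have X0 : 'X != 0 :> {poly K} by rewrite polyX_eq0.
  have := @along_eq0_deriv G C 'X X0 _ 1; rewrite CE scale1r.
  rewrite derivM derivC derivX mul0r add0r mulr1 hornerC; apply=> t.
  rewrite hornerX CE => t0; have st : (11.-root t) ^+ 11 = t by rewrite rootCK.
  rewrite -{1}st -pentZ scalemxAl; apply: Gv; rewrite -scalemxAl.
  by apply: admissibleZ gY; rewrite rootC_eq0.
(* Now the curve whose velocity is v up to a multiple of f and a nonzero factor. *)
have [N N0 Ngood] := admissible_line gY Z0 (sum0_mul p Z0).
have [c cE] := tangent_row_curve Y U p.
have := @along_eq0_deriv G (pent_curve Y (Y *m p) Z (Z *m p)) N N0 _ 0.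
rewrite pent_curve_horner0 => /(_ _) D.
have {}D : (dir_deriv ((\prod_j (Y *m p) j 0) *:
     (pent_curve Y (Y *m p) Z (Z *m p))^`().[0%:MP]) G).@[coordv f] = 0.
  rewrite dir_derivZ mevalZ D ?mulr0 // => t /Ngood.
  by rewrite pent_curve_horner scalemxAl -mulmxDl => /Gv.
move: D; rewrite cE dir_derivD !dir_derivZ -vE mevalD !mevalZ radial mulr0 add0r.
move/eqP; rewrite mulf_eq0 mulrn_eq0 /= expf_eq0 /=.
by case/orP => [/prodf_eq0[j _]|/eqP //]; rewrite (negPf (bn j)).
Qed.

(** The cubics singular at p form a linear space, so an arbitrary one f is joined
    to a member f0 of the family by a segment of such cubics; the derivative of G
    along it is zero by the induction hypothesis, since it has smaller degree. *)
Lemma admissible_dense_at p G : p != 0 ->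
  (forall Y, admissible Y (Y *m p) -> G.@[coordv (pent Y (Y *m p))] = 0) ->
  forall f, f \is 3.-homog -> singular_at p f -> G.@[coordv f] = 0.
Proof.
move=> p0; have [Y0 gY0] := exists_admissible p0.
have [k le_k] := ubnPleq (msize G); elim: k => [|k IH] in G le_k *.
  move=> _ f _ _; move: le_k; rewrite leqn0 msize_poly_eq0 => /eqP ->.
  by rewrite meval0.
move=> Gv f f3 fs; pose f0 := pent Y0 (Y0 *m p).
have f0s : singular_at p f0 by case: gY0 => ? _ _ _; apply: pent_singular.
pose v := f - f0; pose C : {poly {mpoly K[4]}} := f0%:P + v%:P * 'X.
have v3 : v \is 3.-homog by rewrite rpredB ?pent_homog.
have vs : singular_at p v.
  by rewrite /v -scaleN1r; apply/singular_atD/singular_atZ.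
have CE t : C.[t%:MP] = f0 + t *: v.
  by rewrite hornerD hornerM !hornerC hornerX mulrC mul_mpolyC.
have Dv t : (dir_deriv v G).@[coordv (f0 + t *: v)] = 0.
  apply: IH.
  - apply: leq_trans (msize_sum _ _ _) _; apply/bigmax_leqP => j _.
    by apply: leq_trans (msizeZ_le _ _) _; apply: msize_mderiv_le.
  - by move=> Y gY; apply: dir_deriv_vanishes_at_admissible gY.
  - by rewrite rpredD ?pent_homog ?rpredZ.
  - by apply/singular_atD/singular_atZ.
have : (along G C).[1] = (along G C).[0].
  apply: horner_const_deriv => t; rewrite along_deriv CE.
  by rewrite derivD derivM derivX !derivC mul0r !add0r mulr1 hornerC.
by rewrite !along_horner !CE scale1r scale0r addr0 addrC subrK => ->; apply: Gv.
Qed.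

End Density.

(** * First-order properties are generically constant on irreducible sets *)

Section Constructible.

Variables (K : numClosedFieldType) (n : nat).
Implicit Types (x : 'I_n -> K) (X : ('I_n -> K) -> Prop) (G H : {mpoly K[n]}).

Definition env x : seq K := [seq x i | i <- enum 'I_n].

Lemma nth_env x (i : 'I_n) : (env x)`_i = x i.
Proof. by rewrite (nth_map i) ?size_enum_ord // nth_ord_enum. Qed.

Lemma size_env x : size (env x) = n.
Proof. by rewrite size_map size_enum_ord. Qed.

(** Variables of index at least n evaluate to 0, the default value. *)
Lemma rterm_mpoly (t : GRing.term K) : GRing.rterm t ->
  exists H, forall x, GRing.eval (env x) t = H.@[x].
Proof.
elim: t => //=.
- move=> k _; have [lt_kn | le_nk] := ltnP k n.
    by exists 'X_(Ordinal lt_kn) => x; rewrite mevalXU -nth_env.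
  by exists 0 => x; rewrite meval0 nth_default // size_env.
- by move=> c _; exists c%:MP => x; rewrite mevalC.
- by move=> k _; exists k%:R%:MP => x; rewrite mevalC.
- move=> t IHt u IHu /andP[/IHt[H1 E1] /IHu[H2 E2]].
  by exists (H1 + H2) => x; rewrite mevalD E1 E2.
- by move=> t IHt /IHt[H E]; exists (- H) => x; rewrite mevalN E.
- by move=> t IHt k /IHt[H E]; exists (H *+ k) => x; rewrite mevalMn E.
- move=> t IHt u IHu /andP[/IHt[H1 E1] /IHu[H2 E2]].
  by exists (H1 * H2) => x; rewrite mevalM E1 E2.
- move=> t IHt k /IHt[H E]; exists (H ^+ k) => x.
  by rewrite E; elim: k => [|k IHk]; rewrite ?meval1 // !exprS mevalM IHk.
Qed.

Definition nonvanishing X G := exists2 x, X x & G.@[x] != 0.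

(** Irreducibility of the Zariski closure of X: nonempty open subsets meet.
    Nonvanishing of the constant 1 says that X is nonempty. *)
Definition irreducible_set X := nonvanishing X 1 /\
  forall G H, nonvanishing X G -> nonvanishing X H -> nonvanishing X (G * H).

(** An equation G = H either holds on all of X, or fails wherever G - H does not
    vanish; irreducibility lets these open sets be intersected along the
    connectives. *)
Lemma qf_generically_constant X (Q : GRing.formula K) :
  irreducible_set X -> GRing.qf_form Q -> GRing.rformula Q ->
  exists2 G, nonvanishing X G & exists v,
    forall x, X x -> G.@[x] != 0 -> GRing.qf_eval (env x) Q = v.
Proof.
move=> [X1 Xmul].
have comb (op : bool -> bool -> bool) Q1 Q2 :
    (exists2 G, nonvanishing X G & exists v,
       forall x, X x -> G.@[x] != 0 -> GRing.qf_eval (env x) Q1 = v) ->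
    (exists2 G, nonvanishing X G & exists v,
       forall x, X x -> G.@[x] != 0 -> GRing.qf_eval (env x) Q2 = v) ->
    exists2 G, nonvanishing X G & exists v, forall x, X x -> G.@[x] != 0 ->
      op (GRing.qf_eval (env x) Q1) (GRing.qf_eval (env x) Q2) = v.
  move=> [G1 G1X [v1 h1]] [G2 G2X [v2 h2]]; exists (G1 * G2); first exact: Xmul.
  exists (op v1 v2) => x Xx; rewrite mevalM mulf_eq0 negb_or => /andP[n1 n2].
  by rewrite h1 ?h2.
elim: Q => //=.
- by move=> b _ _; exists 1 => //; exists b.
- move=> t u _ /andP[/rterm_mpoly[H1 E1] /rterm_mpoly[H2 E2]].
  have [Hn|Hz] := pselect (nonvanishing X (H1 - H2)).
    exists (H1 - H2) => //; exists false => x _.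
    by rewrite E1 E2 mevalB subr_eq0 => /negPf.
  exists 1 => //; exists true => x Xx _; rewrite E1 E2 -subr_eq0 -mevalB.
  by apply/negP => /negP h; apply: Hz; exists x.
- by move=> Q1 IH1 Q2 IH2 /andP[q1 q2] /andP[r1 r2]; apply: (comb andb); auto.
- by move=> Q1 IH1 Q2 IH2 /andP[q1 q2] /andP[r1 r2]; apply: (comb orb); auto.
- by move=> Q1 IH1 Q2 IH2 /andP[q1 q2] /andP[r1 r2]; apply: (comb implb); auto.
- move=> Q IH q r; have [G GX [v h]] := IH q r.
  by exists G => //; exists (~~ v) => x Xx Gx; rewrite h.
Qed.

Lemma definable_generically_constant X (Q : GRing.formula K) :
  irreducible_set X ->
  exists2 G, nonvanishing X G & forall x y, X x -> X y ->
    G.@[x] != 0 -> G.@[y] != 0 ->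
    GRing.holds (env x) Q -> GRing.holds (env y) Q.
Proof.
move=> irrX; pose P := GRing.to_rform Q.
have wf := @ClosedFieldQE.wf_ex_elim K.
have ok := @ClosedFieldQE.holds_ex_elim K (@solve_monicpoly K).
pose E := GRing.quantifier_elim (@ClosedFieldQE.ex_elim K) P.
have rP : GRing.rformula P by apply: GRing.to_rform_rformula.
have /andP[qE rE] : GRing.qf_form E && GRing.rformula E.
  exact: GRing.quantifier_elim_wf.
have [G GX [v h]] := qf_generically_constant irrX qE rE; exists G => // x y Xx Xy Gx Gy.
have P1 z : GRing.holds (env z) Q <-> GRing.qf_eval (env z) E.
  rewrite -(rwP (GRing.quantifier_elim_rformP wf ok (env z) rP)).
  by split=> /GRing.to_rformP.
by move=> /P1; rewrite h // => vt; apply/P1; rewrite h.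
Qed.

End Constructible.

(** * Sums of r cubes as a first-order formula *)

Section CubeSums.

Variables (K : numClosedFieldType).
Implicit Types (x : 'I_20 -> K).

Definition cubes r (C : 'M[K]_(r, 4)) : {mpoly K[4]} := \sum_i lin (row i C) ^+ 3.

Lemma mcoeff_lin_cube (c : 'rV[K]_4) m : (lin c ^+ 3)@_m =
  \sum_a \sum_b \sum_d (c 0 a * c 0 b * c 0 d) *+ (U_(a) + U_(b) + U_(d) == m)%MM.
Proof.
have cube_sum (F : 'I_4 -> {mpoly K[4]}) :
    (\sum_a F a) ^+ 3 = \sum_a \sum_b \sum_d F a * F b * F d.
  rewrite !exprS expr0 mulr1 mulr_suml; apply: eq_bigr => a _.
  rewrite mulr_suml mulr_sumr; apply: eq_bigr => b _.
  by rewrite !mulr_sumr; apply: eq_bigr => d _; rewrite mulrA.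
rewrite cube_sum raddf_sum /=; apply: eq_bigr => a _; rewrite raddf_sum /=.
apply: eq_bigr => b _; rewrite raddf_sum /=; apply: eq_bigr => d _.
rewrite -!(scalerAl, scalerAr) !scalerA mcoeffZ -!mpolyXD.
by rewrite mcoeffX mulr_natr mulrC.
Qed.

(** The variables 0 to 19 are the coefficients of the cubic; the entries of the
    matrix of linear forms follow from 20 on. *)
Definition cube_var r (i : 'I_r) (k : 'I_4) : GRing.term K :=
  GRing.Var K (20 + mxvec_index i k).

Definition coef_term r (j : 'I_20) : GRing.term K :=
  \big[GRing.Add/GRing.Const 0]_(i < r) \big[GRing.Add/GRing.Const 0]_(a < 4)
  \big[GRing.Add/GRing.Const 0]_(b < 4) \big[GRing.Add/GRing.Const 0]_(d < 4)
   GRing.NatMul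
     (GRing.Mul (GRing.Mul (cube_var i a) (cube_var i b)) (cube_var i d))
     (U_(a) + U_(b) + U_(d) == cubic_monomial j)%MM.

Lemma eval_coef_term r (C : 'M[K]_(r, 4)) (e : seq K) j :
  (forall i k, e`_(20 + mxvec_index i k) = C i k) ->
  GRing.eval e (coef_term r j) = coordv (cubes C) j.
Proof.
move=> eC; rewrite /coordv raddf_sum /coef_term.
have ev I (s : seq I) F : GRing.eval e (\big[GRing.Add/GRing.Const 0]_(i <- s) F i)
    = \sum_(i <- s) GRing.eval e (F i) by apply: big_morph.
rewrite ev; apply: eq_bigr => i _ /=; rewrite mcoeff_lin_cube.
rewrite ev; apply: eq_bigr => a _; rewrite ev; apply: eq_bigr => b _.
by rewrite ev; apply: eq_bigr => d _ /=; rewrite !eC !mxE.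
Qed.

Definition conj_formula (s : seq (GRing.formula K)) := foldr GRing.And GRing.True s.

Lemma holds_conj e (s : seq 'I_20) F :
  GRing.holds e (conj_formula [seq F j | j <- s]) <->
  {in s, forall j, GRing.holds e (F j)}.
Proof.
elim: s => [|j s IH] //=; split=> [[hj /IH hs] i|h].
  by rewrite inE => /orP[/eqP -> //|/hs].
split; first by apply: h; rewrite mem_head.
by apply/IH => i si; apply: h; rewrite inE si orbT.
Qed.

Definition cubes_formula r : GRing.formula K :=
  foldr GRing.Exists
    (conj_formula [seq GRing.Equal (GRing.Var K j) (coef_term r j) | j : 'I_20 <- enum 'I_20])
    (iota 20 (r * 4)).

Lemma cubes_formulaP r x :
  GRing.holds (env x) (cubes_formula r)
  <-> exists C : 'M[K]_(r, 4), x =1 coordv (cubes C).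
Proof.
rewrite -GRing.foldExistsP; split=> [[e ex /holds_conj h]|[C xC]].
  (* The matrix read off the existentially quantified part of the environment. *)
  pose C : 'M[K]_(r, 4) := vec_mx (\row_m e`_(20 + m)).
  exists C => j; rewrite -(@eval_coef_term _ C e) => [|i k]; last first.
    by rewrite -[in RHS]mxvecE vec_mxK mxE.
  rewrite -(h j) ?mem_enum //= -ex ?nth_env // !inE mem_iota negb_and -ltnNge.
  by rewrite ltn_ord.
exists (env x ++ env (fun m => mxvec C 0 m)).
  move=> k; rewrite !inE mem_iota negb_and -!ltnNge nth_cat size_env.
  case: ltnP => //= lek; rewrite ltnS => lek'.
  by rewrite !nth_default ?size_env ?leq_subRL.
apply/holds_conj => j _ /=; rewrite (@eval_coef_term _ C) => [|i k].
  by rewrite nth_cat size_env ltn_ord; exact: etrans (nth_env x j) (xC j).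
rewrite nth_cat size_env ltnNge leq_addr addKn -(mxvecE C i k).
exact: (nth_env (fun m => mxvec C 0 m)).
Qed.

End CubeSums.

(** * The family consists of cubics of rank at least five *)

Section LowerBound.

Variable K : numClosedFieldType.
Implicit Types (Y : 'M[K]_(5, 4)) (p q : 'cV[K]_4) (b : 'cV[K]_5).
Implicit Types (f : {mpoly K[4]}) (C : 'M[K]_4).

(** Its vanishing for some nonzero q means that f is a cone with vertex q. *)
Definition polar q f := \sum_k q k 0 *: f^`M(k).

Lemma cubes_deriv r (C : 'M[K]_(r, 4)) k : (cubes C)^`M(k) =
  \sum_i (C i k *+ 3)%:MP * lin (row i C) ^+ 2.
Proof.
rewrite raddf_sum; apply: eq_bigr => i _ /=.
by rewrite !exprS expr0 !mulr1 !mderivM lin_deriv mxE; ring.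
Qed.

(** If the matrix C of the four forms is invertible, a singular point p has
    sum_i (C p)_i^2 C_ik = 0 for all k, so C p = 0 and p = 0. Otherwise a kernel
    vector of C is a vertex. *)
Lemma singular_cubes4_cone p C : p != 0 -> singular_at p (cubes C) ->
  exists2 q, q != 0 & polar q (cubes C) = 0.
Proof.
move=> p0 sing; have [uC|nC] := boolP (C \in unitmx).
  have v0 : (\row_i ((C *m p) i 0) ^+ 2) *m C = 0.
    apply/rowP => k; have := sing k; rewrite cubes_deriv raddf_sum /= !mxE => e.
    apply: (@mulfI _ 3); first by rewrite pnatr_eq0.
    rewrite mulr0 -[RHS]e mulr_sumr; apply: eq_bigr => i _.
    by rewrite expr2 !mevalM mevalC lin_eval -row_mul !mxE; ring.
  have {}v0 : \row_i ((C *m p) i 0) ^+ 2 = 0 by rewrite -(mulmxK uC (\row_i _)) v0 mul0mx.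
  case/eqP: p0; rewrite -(mulKmx uC p) (_ : C *m p = 0) ?mulmx0 //.
  apply/colP => i; move/rowP/(_ i): v0; rewrite !mxE => /eqP.
  by rewrite expf_eq0 /= => /eqP.
have /det0P[v v0 vC] : \det C^T == 0.
  by rewrite det_tr; move: nC; rewrite unitmxE unitfE negbK.
exists v^T; first by rewrite trmx_eq0.
have Cv : C *m v^T = 0 by rewrite -[C]trmxK -trmx_mul vC trmx0.
rewrite /polar; under eq_bigr do rewrite cubes_deriv scaler_sumr.
rewrite exchange_big big1 // => i _ /=.
transitivity ((3 * (C *m v^T) i 0)%:MP * lin (row i C) ^+ 2).
  rewrite [(C *m _) i 0]mxE mulr_sumr rmorph_sum mulr_suml; apply: eq_bigr => k _ /=.
  by rewrite -mul_mpolyC mulrA -rmorphM; congr (_%:MP * _); ring.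
by rewrite Cv mxE mulr0 mul0r.
Qed.

(** The polar of q is sum_i c_i y_i^2 with c_i proportional to y_i(q). If it is
    zero, then in the coordinates y_0, ..., y_3, where y_4 is minus their sum,
    the squares give c_a = - c_4 and a mixed product gives c_4 = 0; so all y_i
    vanish at q. *)
Lemma pent_not_cone Y b q : admissible Y b -> polar q (pent Y b) = 0 -> q = 0.
Proof.
move=> [Y0 b0 bn uY] cone.
pose c i := cofactor_prod b i ^+ 2 *+ 3 * (Y *m q) i 0.
have quad (x : 'cV[K]_4) : \sum_i c i * (Y *m x) i 0 ^+ 2 = 0.
  rewrite -[RHS](@meval0 4 K (pt x)) -cone /polar.
  under [in RHS]eq_bigr do rewrite pent_deriv scaler_sumr.
  rewrite exchange_big (raddf_sum (meval (pt x))); apply: eq_bigr => i _ /=.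
  rewrite (raddf_sum (meval (pt x))) /c [(Y *m q) i 0]mxE mulr_sumr mulr_suml.
  apply: eq_bigr => k _ /=.
  by rewrite mevalZ expr2 !mevalM mevalC face_eval; ring.
have quad4 (v : 'cV[K]_4) :
    c ord_max * (\sum_a v a 0) ^+ 2 + \sum_a c (lift ord_max a) * v a 0 ^+ 2 = 0.
  pose x := invmx (base_mx Y) *m v.
  have Yx a : (Y *m x) (lift ord_max a) 0 = v a 0.
    by have /colP/(_ a) := mul_base_mx Y x; rewrite mulKVmx // mxE => <-.
  rewrite -[RHS](quad x) [in RHS](bigD1_ord ord_max) //=; congr (_ * _ + _); last first.
    by apply: eq_bigr => a _; rewrite Yx.
  have /sum0P/(_ 0) := sum0_mul x Y0; rewrite (bigD1_ord ord_max) //= => /eqP.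
  by rewrite addr_eq0 => /eqP ->; rewrite sqrrN; under eq_bigr do rewrite -Yx.
(* Evaluation at a basis vector. *)
have c1 a : c (lift ord_max a) = - c ord_max.
  have dE j : delta_mx a 0 j 0 = (j == a)%:R :> K by rewrite mxE eqxx andbT.
  have := quad4 (delta_mx a 0); rewrite (bigD1 a) //= big1 => [|j ja]; last first.
    by rewrite dE (negPf ja).
  rewrite (bigD1 a) //= [X in _ + (_ + X)]big1 => [|j ja]; last first.
    by rewrite dE (negPf ja) expr0n mulr0.
  by rewrite dE eqxx !addr0 !expr1n !mulr1 addrC => /eqP; rewrite addr_eq0 => /eqP.
(* Evaluation at the sum of two basis vectors: 4 c_4 + c_0 + c_1 = 2 c_4. *)
have cmax : c ord_max = 0.
  have := quad4 (delta_mx 0 0 + delta_mx 1 0); rewrite !big_ord_recl !big_ord0 !mxE /= !c1.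
  move=> e; have /eqP : c ord_max *+ 2 = 0 by rewrite -[RHS]e; ring.
  by rewrite mulrn_eq0 => /eqP.
have Yq i : (Y *m q) i 0 = 0.
  have /eqP : c i = 0.
    by case: (unliftP ord_max i) => [a ->|-> //]; rewrite c1 cmax oppr0.
  rewrite mulf_eq0 mulrn_eq0 expf_eq0 /= => /orP[/prodf_eq0[j _]|/eqP //].
  by rewrite (negPf (bn j)).
by rewrite -(mulKmx uY q) mul_base_mx (_ : \col_i _ = 0) ?mulmx0 //;
   apply/colP => i; rewrite !mxE -[RHS](Yq (lift ord_max i)) mxE.
Qed.

Lemma pent_neq0 Y b : admissible Y b -> pent Y b != 0.
Proof.
move=> gY; apply/eqP => f0.
have /colP/(_ 0) : const_mx 1 = 0 :> 'cV[K]_4.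
  apply: pent_not_cone gY _; rewrite f0 /polar big1 // => k _.
  by rewrite mderiv0 scaler0.
by rewrite !mxE => /eqP; rewrite oner_eq0.
Qed.

Lemma pent_cubes5 Y b : exists C : 'M[K]_(5, 4), pent Y b = cubes C.
Proof.
exists (\matrix_(i, k) (3.-root (cofactor_prod b i ^+ 2) * Y i k)).
apply: eq_bigr => i _.
rewrite (_ : row i _ = 3.-root (cofactor_prod b i ^+ 2) *: row i Y).
  by rewrite linZ exprZn rootCK.
by apply/rowP => k; rewrite !mxE.
Qed.

(** Four of the values prescribe p, and the fifth is then right since both the
    values and the forms have sum 0. *)
Lemma admissible_value Y b : admissible Y b -> exists2 p, p != 0 & b = Y *m p.
Proof.
move=> [Y0 b0 bn uY].
pose p := invmx (base_mx Y) *m \col_a b (lift ord_max a) 0.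
have Yp a : (Y *m p) (lift ord_max a) 0 = b (lift ord_max a) 0.
  by have /colP/(_ a) := mul_base_mx Y p; rewrite mulKVmx // !mxE => ->.
have bE : b = Y *m p.
  apply/colP => i; case: (unliftP ord_max i) => [a ->|->]; first by rewrite Yp.
  have /sum0P/(_ 0) := sum0_mul p Y0; have /sum0P/(_ 0) := b0.
  rewrite (bigD1_ord ord_max) //= => bsum; rewrite (bigD1_ord ord_max) //=.
  by under eq_bigr do rewrite Yp; rewrite -[RHS]bsum => /addIr.
exists p => //; apply/eqP => p0; have := bn 0.
by rewrite bE p0 mulmx0 mxE eqxx.
Qed.

Lemma pent_not_cubes4 Y b C : admissible Y b -> pent Y b <> cubes C.
Proof.
move=> gY e; have [p p0 bE] := admissible_value gY; have [Y0 _ _ _] := gY.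
have [|q q0 /= cone] := @singular_cubes4_cone p C p0.
  by rewrite -e bE; apply: pent_singular.
by case/eqP: q0; apply: (pent_not_cone gY); rewrite e.
Qed.

End LowerBound.

(** * Irreducibility of the discriminant and the generic rank *)

Section Discriminant.

Variable K : numClosedFieldType.
Implicit Types (G H : {mpoly K[20]}) (f : {mpoly K[4]}).

Definition singular_cubic f := f \is 3.-homog /\ exists2 p, p != 0 & singular_at p f.

(** The affine cone over the discriminant, with the zero cubic. *)
Definition singular_locus (x : 'I_20 -> K) := exists2 f, singular_cubic f & x = coordv f.

Lemma admissible_singular Y b : admissible Y b -> singular_cubic (pent Y b).
Proof.
move=> gY; split; first exact: pent_homog.
have [p p0 ->] := admissible_value gY; exists p => //.
by apply: pent_singular; case: gY.
Qed.

Lemma nonvanishing_admissible G : nonvanishing singular_locus G ->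
  exists Y b, admissible Y b /\ G.@[coordv (pent Y b)] != 0.
Proof.
move=> [_ [f [f3 [p p0 fs]] ->] Gf]; apply: contrapT => none.
case/eqP: Gf; apply: (admissible_dense_at p0) f3 fs => Y gY.
by apply: contrapT => /eqP GY; apply: none; exists Y, (Y *m p).
Qed.

(** By density, each of two polynomials not vanishing identically is nonzero at
    some member of the family; both, and the admissibility condition, are nonzero
    somewhere on the line joining the two parameters. *)
Lemma singular_locus_irreducible : irreducible_set singular_locus.
Proof.
split.
  have [|Y gY] := @exists_admissible K (const_mx 1).
    by apply/eqP => /colP/(_ 0); rewrite !mxE => /eqP; rewrite oner_eq0.
  exists (coordv (pent Y (Y *m const_mx 1))); last by rewrite meval1 oner_neq0.
  by eexists; [exact: admissible_singular gY|].
move=> G H /nonvanishing_admissible[Y [b [gY GY]]] /nonvanishing_admissible[Y' [b' [gY' HY']]].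
have diff0 m (A B : 'M[K]_(5, m)) : sum0 A -> sum0 B -> sum0 (B - A).
  by rewrite /sum0 mulmxBr => -> ->; rewrite subrr.
have [[Y0 b0 _ _] [Y0' b0' _ _]] := (gY, gY').
have [N N0 Ngood] := admissible_line gY (diff0 _ _ _ Y0 Y0') (diff0 _ _ _ b0 b0').
pose C := pent_curve Y b (Y' - Y) (b' - b).
have C0 : C.[0%:MP] = pent Y b by rewrite pent_curve_horner !scale0r !addr0.
have C1 : C.[1%:MP] = pent Y' b'.
  by rewrite pent_curve_horner !scale1r ![_ + (_ - _)]addrC !subrK.
have [t] : exists t, (N * (along G C * along H C)).[t] != 0.
  apply: poly_nonroot; rewrite !mulf_neq0 //.
    by apply: contraNneq GY => e; rewrite -C0 -along_horner e horner0.
  by apply: contraNneq HY' => e; rewrite -C1 -along_horner e horner0.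
rewrite !hornerM !mulf_eq0 !negb_or !along_horner => /and3P[/Ngood gt Gt Ht].
exists (coordv C.[t%:MP]); last by rewrite mevalM mulf_neq0.
by eexists; [|reflexivity]; rewrite pent_curve_horner; apply: admissible_singular.
Qed.

Lemma meval_homog n (G : {mpoly K[n]}) d t (x : 'I_n -> K) : G \is d.-homog ->
  G.@[fun i => t * x i] = t ^+ d * G.@[x].
Proof.
move=> /dhomogP hG; rewrite !mevalE mulr_sumr !big_seq; apply: eq_bigr => m /hG /= md.
rewrite mulrCA; congr (_ * _); under eq_bigr do rewrite exprMn.
by rewrite big_split /= prodrXr -md mdegE.
Qed.

Lemma coordv_inj f g : f \is 3.-homog -> g \is 3.-homog -> coordv f =1 coordv g ->
  f = g.
Proof.
move=> /dhomogP f3 /dhomogP g3 e; apply/mpolyP => m.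
have [/cubic_monomialP[i ->]|m3] := boolP (mdeg m == 3%N); first exact: e.
by rewrite !memN_msupp_eq0 //; [apply: contra m3 => /g3/= -> | apply: contra m3 => /f3/= ->].
Qed.

Lemma coordvZ a f : coordv (a *: f) = (fun i => a * coordv f i).
Proof. by apply/funext => i; rewrite /coordv mcoeffZ. Qed.

Lemma cubes_homog r (C : 'M[K]_(r, 4)) : cubes C \is 3.-homog.
Proof. by apply: rpred_sum => i _; apply: lin_cube_homog. Qed.

Definition cubes5_not4 f :=
  (exists C : 'M[K]_(5, 4), f = cubes C) /\ ~ exists C : 'M[K]_4, f = cubes C.

Lemma cubes_formula_coordv r f : f \is 3.-homog ->
  GRing.holds (env (coordv f)) (cubes_formula K r)
  <-> exists C : 'M[K]_(r, 4), f = cubes C.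
Proof.
move=> f3; rewrite cubes_formulaP; split=> -[C e]; exists C; last by rewrite e.
by apply: coordv_inj; rewrite ?cubes_homog.
Qed.

(** The constant generic truth value is tested at a member of the family where G
    does not vanish, which exists by density. *)
Lemma generic_cubes5_not4 : exists2 G, nonvanishing singular_locus G &
  forall f, singular_cubic f -> G.@[coordv f] != 0 -> cubes5_not4 f.
Proof.
pose Q := GRing.And (cubes_formula K 5) (GRing.Not (cubes_formula K 4)).
have QP f : f \is 3.-homog -> GRing.holds (env (coordv f)) Q <-> cubes5_not4 f.
  move=> f3; have := cubes_formula_coordv 5 f3; have := cubes_formula_coordv 4 f3.
  by rewrite /cubes5_not4 /=; tauto.
have [G GX const] := definable_generically_constant Q singular_locus_irreducible.
exists G => // f fs Gf; apply/QP; first by case: fs.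
have [Y [b [gY GY]]] := nonvanishing_admissible GX.
apply: (const (coordv (pent Y b))) => //.
- by exists (pent Y b) => //; apply: admissible_singular.
- by exists f.
apply/QP; first exact: pent_homog.
split; first exact: pent_cubes5.
by move=> [C]; apply: pent_not_cubes4.
Qed.

(** If the component of degree d of G is nonzero at f, then G is nonzero at t f
    for almost all t, since t |-> G(t f) is a polynomial whose coefficient of t^d
    is the value of that component. *)
Lemma generic_cubes5_not4_homog : exists H d,
  [/\ H \is d.-homog, nonvanishing singular_locus H &
  forall f, singular_cubic f -> H.@[coordv f] != 0 ->
    exists2 t, t != 0 & cubes5_not4 (t *: f)].
Proof.
have [G [x Xx Gx] good5] := generic_cubes5_not4.
pose k := msize G; pose part d := pihomog mdeg d G.
have partE y : G.@[y] = \sum_(d < k) (part d).@[y].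
  by rewrite {1}(@pihomog_partitionE _ _ mdeg k G) // raddf_sum.
have [d dx] : exists d : 'I_k, (part d).@[x] != 0.
  apply/existsP; rewrite -negb_forall; apply: contra Gx => /forallP h.
  by rewrite partE big1 // => d _; apply/eqP.
exists (part d), d; split; [exact: pihomogP|by exists x|move=> f fs fd].
pose P : {poly K} := \poly_(e < k) (part e).@[coordv f].
have PE t : P.[t] = G.@[coordv (t *: f)].
  rewrite horner_poly coordvZ partE; apply: eq_bigr => e _.
  by rewrite (@meval_homog _ _ e) ?pihomogP // mulrC.
have [t] : exists t, ('X * P).[t] != 0.
  apply: poly_nonroot; rewrite mulf_neq0 ?polyX_eq0 //.
  by apply: contraNneq fd => P0; have := coef_poly k (fun e => (part e).@[coordv f]) d;
     rewrite -/P P0 coef0 ltn_ord => <-.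
rewrite hornerM hornerX mulf_eq0 negb_or PE => /andP[t0 Gt]; exists t => //.
apply: good5 => //; case: fs => [f3 [p p0 fs]]; split; first exact: rpredZ.
by exists p => //; apply: singular_atZ.
Qed.

End Discriminant.

(** * Translation to rank and to points of P^19 *)

Section RankOfSurfaces.

Variable R : realType.
Local Notation K := (R[i]).

Lemma sum_of_cubesP (f : {mpoly K[4]}) r :
  sum_of_cubes f r <-> exists C : 'M[K]_(r, 4), f = cubes C.
Proof.
split=> [[l l1 ->]|[C ->]].
  have /choice[c lc] : forall i, exists c, l i = lin c.
    by move=> i; apply: homog1_lin.
  by exists (\matrix_i c i); apply: eq_bigr => i _; rewrite rowK lc.
by exists (fun i => lin (row i C)) => // i; apply: lin_homog.
Qed.

(** Zero forms are allowed as summands. *)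
Lemma sum_of_cubes_leq (f : {mpoly K[4]}) r s : (r <= s)%N ->
  sum_of_cubes f r -> sum_of_cubes f s.
Proof.
move=> /subnK <-; elim: (s - r)%N => // n IH /IH[l l1 ->].
exists (fun i : 'I_(n + r).+1 => if unlift ord_max i is Some j then l j else 0).
  by move=> i; case: unlift => [j|]; [exact: l1|exact: rpred0].
rewrite (bigD1_ord ord_max) //= unlift_none expr0n add0r.
by apply: eq_bigr => i _; rewrite liftK.
Qed.

Lemma cubes5_not4_rank (f : {mpoly K[4]}) : cubes5_not4 f -> has_rank f 5.
Proof.
move=> [/sum_of_cubesP f5 f4]; split=> // s fs; rewrite leqNgt; apply/negP => s5.
by apply/f4/sum_of_cubesP; apply: sum_of_cubes_leq fs.
Qed.

Lemma singular_formP (f : {mpoly K[4]}) :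
  singular_form f <-> exists2 p : 'cV[K]_4, p != 0 & singular_at p f.
Proof.
split=> [[p [i pi] fs]|[p p0 fs]].
  exists (\col_k p k).
    by apply/eqP => /colP/(_ i); rewrite !mxE; apply/eqP.
  by move=> k; rewrite -[RHS](fs k); apply: meval_eq => j; rewrite /pt mxE.
exists (pt p) => //; apply: contrapT => none; case/eqP: p0.
apply/colP => i; rewrite mxE; apply: contrapT => /eqP pi.
by apply: none; exists i.
Qed.

Lemma equation_homog (X : cubic_surface R) : equation X \is 3.-homog.
Proof. by rewrite /equation; case/andP: (valP (repr X)). Qed.

Lemma discriminant_singular (X : cubic_surface R) :
  discriminant X -> singular_cubic (equation X).
Proof. by move=> /singular_formP; split; first exact: equation_homog. Qed.

End RankOfSurfaces.

Local Open Scope classical_set_scope.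

Theorem corollary4p5 (R : realType) :
  exists U : set (cubic_surface R),
    [/\ zariski_open_in (@discriminant R) U,
        zariski_dense_in (@discriminant R) U
      & forall X : cubic_surface R, U X -> has_rank (equation X) 5].
Proof.
have [H [d [Hd HX H5]]] := generic_cubes5_not4_homog R[i].
pose Z : set (cubic_surface R) := [set X | H.@[coordinates X] = 0].
exists (@discriminant R `&` ~` Z); split.
- exists (~` Z) => //; rewrite /zariski_open setCK; exists [set H]; split.
    by move=> _ ->; exists d.
  by move=> X; split=> [ZX _ -> //|]; apply.
- move=> O [S [Shom SE]] [X0 [DX0 OX0]].
  have [G SG GX0] : exists2 G, S G & G.@[coordinates X0] != 0.
    apply: contrapT => none; have : (~` O) X0; last by [].
    by apply/SE => G SG; apply: contrapT => /eqP GX; apply: none; exists G.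
  have [e Ge] := Shom _ SG.
  (* Irreducibility and density give a member of the family which lies in O and
     where H is nonzero; it is the required point of U and O. *)
  have [_ Xmul] := singular_locus_irreducible R[i].
  have GX : nonvanishing (@singular_locus _) G.
    by exists (coordv (equation X0)) => //; exists (equation X0) => //;
       exact: discriminant_singular.
  have [Y [b [gY]]] := nonvanishing_admissible (Xmul _ _ GX HX).
  rewrite mevalM mulf_eq0 negb_or => /andP[GY HY].
  have okY : (pent Y b \is 3.-homog) && (pent Y b != 0).
    by rewrite pent_homog pent_neq0.
  pose X : cubic_surface R := \pi_(cubic_surface R)%qT (exist _ (pent Y b) okY : cubic_form R).
  have [c c0 /= XE] := equation_pi (exist _ (pent Y b) okY : cubic_form R).
  have coordE : coordinates X = fun i => c * coordv (pent Y b) i.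
    by rewrite -coordvZ -XE.
  exists X; split; first split.
  + rewrite /discriminant /= XE; apply/singular_formZ => //; apply/singular_formP.
    by have [] := admissible_singular gY.
  + by rewrite /Z /= coordE (meval_homog _ _ Hd) => /eqP; apply/negP; rewrite mulf_neq0 ?expf_neq0.
  + apply: contrapT => /SE /(_ G SG); rewrite coordE (meval_homog _ _ Ge).
    by apply/eqP; rewrite mulf_neq0 ?expf_neq0.
- move=> X [DX ZX].
  have [||t t0 /cubes5_not4_rank] := H5 (equation X); first exact: discriminant_singular.
    exact/eqP.
  by move/(has_rankZ _ _ t0).
Qed.
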